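(* Let $p>2$ be a prime, $\mathbf{F}$ a field of characteristic $p$, $M=(c_{ij})\in\mathbf{F}^{2\times2}$, and let $V_M$ be the associated three-dimensional representation of $G=(\mathbf{Z}/p)^2=\langle e_1,e_2\rangle$, so that $G$ acts on $\mathbf{F}[V_M]=\mathbf{F}[x,y,z]$ by algebra automorphisms with $x\cdot e_i=x$, $y\cdot e_i=y+c_{1i}x$, $z\cdot e_i=z+2c_{1i}y+(c_{1i}^2+c_{2i})x$ for $i=1,2$. Let $\overline\gamma_{ij}$, $d$, $N_G(y)$, $N_G(z)$ be as defined in the context. If $\overline\gamma_{13}\neq0$ and $\overline\gamma_{12}=0$, then $\{x,d,N_G(y),N_G(z)\}$ is a SAGBI basis for $\mathbf{F}[V_M]^G$ with respect to the graded reverse lexicographic order with $x<y<z$. Furthermore, there is a single relation among the generators, constructed by subducting $d^{p^2}-\overline\gamma_{13}^{\,p^2}N_G(y)^2$.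
   Context: Let $\delta=y^2-xz$. Let $\overline\gamma_{ij}\in\mathbf{F}$ be the $2\times 2$ minor, on rows $i<j$, of the matrix with rows $(c_{11},c_{12})$, $(c_{21},c_{22})$, $(c_{11}^p,c_{12}^p)$ (rows $1$ to $3$). When $\overline\gamma_{12}=0$, define the invariant $d=\overline\gamma_{13}\delta+\overline\gamma_{23}yx$. For $f\in\mathbf{F}[x,y,z]$, $N_G(f)$ is the product of the (distinct) elements of the $G$-orbit of $f$. A subset $\mathcal{B}$ of a subalgebra $A$ of a polynomial ring is a SAGBI basis for $A$ if the lead monomials of the elements of $\mathcal{B}$ generate, as an algebra, the lead term algebra of $A$ (the algebra spanned by the lead monomials of nonzero elements of $A$); then $\mathcal{B}$ generates $A$. To subduct a polynomial $F$ over $\mathcal{B}$ is to repeatedly subtract from it scalar multiples of products of elements of $\mathcal{B}$ having the same lead term as the current polynomial; for a SAGBI basis, every $F\in A$ subducts to $0$. If $F$ is a polynomial expression in elements of $\mathcal{B}$, its subduction to $0$ yields an identity $F-\sum_I c_I\,b^I=0$ with products $b^I$ of elements of $\mathcal{B}$: this is the relation constructed by subducting $F$. ''A single relation'' means that the ideal of all algebraic relations among the listed generators is generated by that one relation. *)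

(* Defs.v *)
From HB Require Import structures.
From mathcomp Require Import all_boot all_order all_algebra.
From mathcomp Require Export mpoly.
From mathcomp Require Import ring.

Set Implicit Arguments.
Unset Strict Implicit.
Unset Printing Implicit Defensive.

Import GRing.Theory.
Local Open Scope ring_scope.

Section TermOrder.

Variables (n : nat) (F : fieldType).
Implicit Types (m : 'X_{1..n}) (f : {mpoly F[n]}).

(* Graded reverse lexicographic order with 'X_0 < 'X_1 < ... < 'X_n.-1: in equal
   degree, the larger exponent of the smallest variable where the monomials
   differ gives the smaller monomial. The order carried by 'X_{1..n} in mpoly,
   and hence mlead, is the graded lexicographic one, whatever its header says. *)
Definition grevlex_lt m1 m2 : bool :=
  (mdeg m1 < mdeg m2)%N ||
  (mdeg m1 == mdeg m2) &&
  [exists i : 'I_n, (m2 i < m1 i)%N &&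
     [forall j : 'I_n, (j < i)%N ==> (m1 j == m2 j)]].

Definition is_lead_mon f m : bool :=
  (m \in msupp f) && all (fun m' => (m' == m) || grevlex_lt m' m) (msupp f).

Definition same_lead_term f g : Prop :=
  exists m, [/\ is_lead_mon f m, is_lead_mon g m & f@_m = g@_m].

Definition lead_monomials (S : {pred {mpoly F[n]}}) (g : {mpoly F[n]}) : Prop :=
  exists f m, [/\ f \in S, is_lead_mon f m & g = 'X_[m]].

Definition linear_span (S : {mpoly F[n]} -> Prop) (f : {mpoly F[n]}) : Prop :=
  exists (k : nat) (c : 'I_k -> F) (s : 'I_k -> {mpoly F[n]}),
    (forall i, S (s i)) /\ f = \sum_(i < k) c i *: s i.

Definition generated_algebra (S : {mpoly F[n]} -> Prop) (f : {mpoly F[n]}) :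
    Prop :=
  exists (k : nat) (s : k.-tuple {mpoly F[n]}) (q : {mpoly F[k]}),
    (forall i, S (tnth s i)) /\ f = q \mPo s.

Definition lead_term_algebra (A : {pred {mpoly F[n]}}) : {mpoly F[n]} -> Prop :=
  linear_span (lead_monomials A).

Definition sagbi_basis (A B : {pred {mpoly F[n]}}) : Prop :=
  {subset B <= A} /\
  (forall f, generated_algebra (lead_monomials B) f <-> lead_term_algebra A f).

(* [subducts_to_zero b f q]: some complete run of the subduction of f over the
   family b ends at 0, and q = \sum_I c_I 'X_[I] records the products c_I b^I
   subtracted along the run. *)
Inductive subducts_to_zero (k : nat) (b : k.-tuple {mpoly F[n]}) :
    {mpoly F[n]} -> {mpoly F[k]} -> Prop :=
| Subduct_done : subducts_to_zero b 0 0
| Subduct_step (f : {mpoly F[n]}) (c : F) (I : 'X_{1..k}) (q : {mpoly F[k]}) :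
    same_lead_term f (c *: ('X_[I] \mPo b)) ->
    subducts_to_zero b (f - c *: ('X_[I] \mPo b)) q ->
    subducts_to_zero b f (c *: 'X_[I] + q).

(* The relation P - \sum_I c_I 'X_[I] obtained from a subduction to 0 of the
   polynomial expression P(b) in the elements of b. *)
Definition subduction_relation (k : nat) (b : k.-tuple {mpoly F[n]})
    (P r : {mpoly F[k]}) : Prop :=
  exists2 q, subducts_to_zero b (P \mPo b) q & r = P - q.

Definition relation_ideal_generated_by (k : nat) (b : k.-tuple {mpoly F[n]})
    (r : {mpoly F[k]}) : Prop :=
  forall q : {mpoly F[k]}, q \mPo b = 0 <-> exists u, q = u * r.

End TermOrder.

Section Representation.

Variables (F : fieldType) (p : nat) (M : 'M[F]_2).

Definition x : {mpoly F[3]} := 'X_0.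
Definition y : {mpoly F[3]} := 'X_1.
Definition z : {mpoly F[3]} := 'X_2.

Definition elementary_images (c1 c2 : F) : 3.-tuple {mpoly F[3]} :=
  [tuple x; y + c1 *: x; z + (2%:R * c1) *: y + (c1 ^+ 2 + c2) *: x].

(* f . e_1 is [act_gen 0 f] and f . e_2 is [act_gen 1 f]; c_{ij} of the paper
   is the entry M i j with indices shifted to start at 0. *)
Definition act_gen (i : 'I_2) (f : {mpoly F[3]}) : {mpoly F[3]} :=
  f \mPo elementary_images (M 0 i) (M 1 i).

(* The right action of e_1^g.1 e_2^g.2; see act0 and actD below. *)
Definition act (g : 'Z_p * 'Z_p) (f : {mpoly F[3]}) : {mpoly F[3]} :=
  iter g.2 (act_gen 1) (iter g.1 (act_gen 0) f).

Definition invariants : {pred {mpoly F[3]}} :=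
  [pred f | [forall g : 'Z_p * 'Z_p, act g f == f]].

Definition orbit_product (f : {mpoly F[3]}) : {mpoly F[3]} :=
  \prod_(h <- undup [seq act g f | g : 'Z_p * 'Z_p]) h.

Definition gamma_matrix : 'M[F]_(3, 2) :=
  \matrix_(k, j) [tuple M 0 j; M 1 j; M 0 j ^+ p]`_k.

(* The 2x2 minor on rows i, j, again with indices starting at 0. *)
Definition gamma_minor (i j : 'I_3) : F :=
  \det (rowsub (tnth [tuple i; j]) gamma_matrix).

Definition delta : {mpoly F[3]} := y ^+ 2 - x * z.

Definition d_inv : {mpoly F[3]} :=
  gamma_minor 0 2 *: delta + gamma_minor 1 2 *: (y * x).

Definition VM_generators : 4.-tuple {mpoly F[3]} :=
  [tuple x; d_inv; orbit_product y; orbit_product z].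

End Representation.

Section ActionFacts.

Variables (F : fieldType) (p : nat) (M : 'M[F]_2).

Lemma elementary_imagesD (a b a' b' : F) (f : {mpoly F[3]}) :
  (f \mPo elementary_images a b) \mPo elementary_images a' b' =
  f \mPo elementary_images (a + a') (b + b').
Proof.
elim/mpolyind: f => [|c m f _ _ IHf]; first by rewrite !comp_mpoly0.
rewrite !comp_mpolyD {}IHf !comp_mpolyZ; congr (_ *: _ + _).
rewrite !comp_mpolyX rmorph_prod /=; apply: eq_bigr => i _.
rewrite rmorphXn /=; congr (_ ^+ _).
case: i => [[|[|[|i]]] Hi] //=; rewrite !(tnth_nth 0) /=.
- by rewrite /x comp_mpolyXU.
- rewrite comp_mpolyD comp_mpolyZ /x /y !comp_mpolyXU /= /x /y.
  by rewrite -addrA -scalerDl [a' + a]addrC.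
rewrite !comp_mpolyD !comp_mpolyZ /x /y /z !comp_mpolyXU /= /x /y /z.
rewrite -!mul_mpolyC !(rmorphD, rmorphM, rmorphXn) /=.
by ring.
Qed.

Lemma iter_act_gen (i : 'I_2) (k : nat) (f : {mpoly F[3]}) :
  iter k (act_gen M i) f =
  f \mPo elementary_images (M 0 i *+ k) (M 1 i *+ k).
Proof.
elim: k => [|k IHk] /=.
  rewrite -[LHS]comp_mpoly_id; congr (_ \mPo _); apply: eq_from_tnth => j.
  rewrite tnth_mktuple (tnth_nth 0) /= expr0n /= !mulr0 !addr0 !scale0r.
  case: j => [[|[|[|j]]] Hj] //=; rewrite ?addr0 /x /y /z;
    by congr ('X_ _); apply: val_inj.
by rewrite IHk /act_gen elementary_imagesD -!mulrSr.
Qed.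

Lemma actE (g : 'Z_p * 'Z_p) (f : {mpoly F[3]}) :
  act M g f = f \mPo elementary_images (M 0 0 *+ g.1 + M 0 1 *+ g.2)
                                       (M 1 0 *+ g.1 + M 1 1 *+ g.2).
Proof. by rewrite /act !iter_act_gen elementary_imagesD. Qed.

Lemma act0 (f : {mpoly F[3]}) : act M (0 : 'Z_p * 'Z_p) f = f.
Proof. by []. Qed.

Lemma actD (g h : 'Z_p * 'Z_p) (f : {mpoly F[3]}) :
  p \in [pchar F] -> act M (g + h) f = act M h (act M g f).
Proof.
move=> pF; have p_gt1 := prime_gt1 (pcharf_prime pF).
have modp (c : F) k : c *+ (k %% p) = c *+ k.
  rewrite [in RHS](divn_eq k p) mulrnDr mulnC mulrnA -[c *+ p]mulr_natr.
  by rewrite (pcharf0 pF) mulr0 mul0rn add0r.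
have modE (c : F) (a b : 'Z_p) : c *+ (a + b)%R = c *+ a + c *+ b.
  rewrite -mulrnDr -[RHS]modp; congr (_ *+ _) => /=.
  by congr (_ %% _)%N; rewrite Zp_cast.
rewrite !actE elementary_imagesD /= !modE.
by congr (_ \mPo elementary_images _ _); rewrite addrACA.
Qed.

End ActionFacts.

(* Main.v *)
(* Put lam = c_21 / c_11. Since gamma_12 = 0, the group is the additive group W
   of the translations t = c_11 i + c_12 j, acting by y -> y + t x and
   z -> z + 2 t y + (t^2 + lam t) x, and d = gamma_13 D with
   D = y^2 - x z + lam x y. The generators b have lead monomials x, y^2, y^(p^2),
   z^(p^2).

   With u = y + t x one has x (z + 2 t y + (t^2 + lam t) x) = u^2 + lam x u - D,
   the norm of u - C for C the companion matrix of T^2 + lam x T - D. As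
   L(Y) = prod_t (Y + t x) is additive, x^(p^2) N(z) = det (N(y) - L(C)): a
   relation that is monic of degree 2 in the variable of N(y). Hence every
   element of F[b] is h(b) with h of degree at most 1 in that variable, and p
   being odd the monomials of such an h have pairwise distinct lead monomials in b.

   In the coordinates x, u = y / x, w = D / x^2 the group only translates u, so
   x^e f lies in F[b] for every invariant f and some e. Comparing lead monomials
   one can divide by x, and f = h(b) follows with h as above. This h is a
   subduction of f to 0, and gives the SAGBI property. A relation obtained by
   subduction is again monic of degree 2 up to a unit, so division by it reduces
   every relation among b to such an h, which must be 0. *)
Require Import Defs.
From mathcomp Require Import all_boot all_order all_algebra.
From mathcomp Require Import zify ring.
Import GRing.Theory.
Local Open Scope ring_scope.

Set Implicit Arguments.
Unset Strict Implicit.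
Unset Printing Implicit Defensive.

(** * The graded reverse lexicographic order in three variables *)

Section Grevlex3.

Implicit Types (m : 'X_{1..3}).

Lemma ord3P (P : 'I_3 -> Prop) : P 0 -> P 1 -> P 2 -> forall i, P i.
Proof.
move=> P0 P1 P2 [[|[|[|i]]] Hi] //; [move: P0|move: P1|move: P2];
  by congr P; apply: val_inj.
Qed.

Lemma mnm3_eq m m' : m 0 = m' 0 -> m 1 = m' 1 -> m 2 = m' 2 -> m = m'.
Proof. by move=> h0 h1 h2; apply/mnmP; apply: ord3P. Qed.

Lemma mdeg3 m : mdeg m = (m 0%R + m 1%R + m 2%R)%N.
Proof.
rewrite mdegE !big_ord_recl big_ord0 addn0 addnA.
by congr (m _ + m _ + m _)%N; apply: val_inj.
Qed.

(** Without quantifiers, questions about the order become linear arithmetic in the three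
    exponents. *)
Lemma grevlex3E m m' : grevlex_lt m m' =
  (mdeg m < mdeg m')%N || (mdeg m == mdeg m') &&
  ((m' 0%R < m 0%R)%N || (m 0 == m' 0) &&
  ((m' 1%R < m 1%R)%N || (m 1 == m' 1) && (m' 2%R < m 2%R)%N)).
Proof.
rewrite /grevlex_lt; congr (_ || _ && _); apply/existsP/idP.
  case=> i /andP[]; elim/ord3P: i => [->//|lt1 /forallP H|lt2 /forallP H].
    by have /= -> := H 0%R; rewrite lt1 orbT.
  by have /= -> := H 0%R; have /= -> := H 1%R; rewrite lt2 !orbT.
case/orP=> [lt0|/andP[e0 /orP[lt1|/andP[e1 lt2]]]].
- by exists 0%R; rewrite lt0; apply/forallP; apply: ord3P.
- by exists 1%R; rewrite lt1; apply/forallP; apply: ord3P; rewrite //= e0.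
- by exists 2%R; rewrite lt2; apply/forallP; apply: ord3P; rewrite //= ?e0 ?e1.
Qed.

Lemma grevlex_irr m : grevlex_lt m m = false.
Proof. by rewrite grevlex3E mdeg3; lia. Qed.

Lemma grevlex_trans m1 m2 m3 :
  grevlex_lt m1 m2 -> grevlex_lt m2 m3 -> grevlex_lt m1 m3.
Proof. by rewrite !grevlex3E !mdeg3; lia. Qed.

Lemma grevlex_total m m' : m != m' -> grevlex_lt m m' || grevlex_lt m' m.
Proof.
apply: contraR; rewrite !grevlex3E !mdeg3 => H; apply/eqP.
by apply: mnm3_eq; lia.
Qed.

Definition grevlex_le m m' := (m == m') || grevlex_lt m m'.

Lemma grevlex_le_refl m : grevlex_le m m.
Proof. by rewrite /grevlex_le eqxx. Qed.

Lemma grevlex_lt_le_trans m1 m2 m3 :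
  grevlex_lt m1 m2 -> grevlex_le m2 m3 -> grevlex_lt m1 m3.
Proof. by move=> h12 /orP[/eqP <- //|]; apply: grevlex_trans. Qed.

Lemma grevlex_le_lt_trans m1 m2 m3 :
  grevlex_le m1 m2 -> grevlex_lt m2 m3 -> grevlex_lt m1 m3.
Proof. by case/orP=> [/eqP -> //|]; apply: grevlex_trans. Qed.

Lemma grevlex_ltD2r m1 m2 m :
  grevlex_lt (m1 + m)%MM (m2 + m)%MM = grevlex_lt m1 m2.
Proof. by rewrite !grevlex3E !mdeg3 !mnmDE; lia. Qed.

Lemma grevlex_leD m1 m2 m1' m2' : grevlex_le m1 m2 -> grevlex_le m1' m2' ->
  grevlex_le (m1 + m1')%MM (m2 + m2')%MM.
Proof.
case/orP=> [/eqP ->|h] /orP[/eqP ->|h']; rewrite /grevlex_le ?eqxx //.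
- by rewrite ![(m2 + _)%MM]addmC grevlex_ltD2r h' orbT.
- by rewrite grevlex_ltD2r h orbT.
rewrite (@grevlex_trans _ (m2 + m1')%MM) ?orbT ?grevlex_ltD2r //.
by rewrite ![(m2 + _)%MM]addmC grevlex_ltD2r.
Qed.

Lemma grevlex_ltleD m1 m2 m1' m2' : grevlex_lt m1 m2 -> grevlex_le m1' m2' ->
  grevlex_lt (m1 + m1')%MM (m2 + m2')%MM.
Proof.
move=> lt12 le12'; apply: (@grevlex_lt_le_trans _ (m2 + m1')%MM).
  by rewrite grevlex_ltD2r.
by apply: grevlex_leD => //; apply: grevlex_le_refl.
Qed.

End Grevlex3.

(** * Support bounds, lead monomials and lead coefficients *)

Section Leading.

Variable F : fieldType.
Implicit Types (f g : {mpoly F[3]}) (m : 'X_{1..3}).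

Definition supp_lt m f := forall m', m' \in msupp f -> grevlex_lt m' m.
Definition supp_le m f := forall m', m' \in msupp f -> grevlex_le m' m.

Lemma supp_ltW m f : supp_lt m f -> supp_le m f.
Proof. by move=> H m' /H lt; rewrite /grevlex_le lt orbT. Qed.

Lemma supp_lt0 m : supp_lt m 0.
Proof. by move=> m'; rewrite msupp0. Qed.

Lemma supp_le_lt m m1 f : supp_le m f -> grevlex_lt m m1 -> supp_lt m1 f.
Proof. by move=> H lt m' /H le; apply: grevlex_le_lt_trans lt. Qed.

Lemma supp_ltD m f g : supp_lt m f -> supp_lt m g -> supp_lt m (f + g).
Proof. by move=> Hf Hg m' /msuppD_le; rewrite mem_cat => /orP[/Hf|/Hg]. Qed.

Lemma supp_leD m f g : supp_le m f -> supp_le m g -> supp_le m (f + g).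
Proof. by move=> Hf Hg m' /msuppD_le; rewrite mem_cat => /orP[/Hf|/Hg]. Qed.

Lemma supp_ltZ m c f : supp_lt m f -> supp_lt m (c *: f).
Proof. by move=> Hf m' /msuppZ_le /Hf. Qed.

Lemma supp_leZ m c f : supp_le m f -> supp_le m (c *: f).
Proof. by move=> Hf m' /msuppZ_le /Hf. Qed.

Lemma supp_ltB m f g : supp_lt m f -> supp_lt m g -> supp_lt m (f - g).
Proof. by move=> Hf Hg; rewrite -scaleN1r; apply/supp_ltD/supp_ltZ. Qed.

Lemma supp_leX m : supp_le m 'X_[m].
Proof. by move=> m'; rewrite msuppX inE => /eqP ->; apply: grevlex_le_refl. Qed.

Lemma supp_ltX m m1 : grevlex_lt m m1 -> supp_lt m1 ('X_[m] : {mpoly F[3]}).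
Proof. exact/supp_le_lt/supp_leX. Qed.

Lemma supp_lt_coef0 m f : supp_lt m f -> f@_m = 0.
Proof.
by move=> H; apply: memN_msupp_eq0; apply/negP=> /H; rewrite grevlex_irr.
Qed.

Lemma supp_ltP m f : supp_le m f -> f@_m = 0 -> supp_lt m f.
Proof.
move=> H c0 m' m'f; case/orP: (H _ m'f) => // /eqP e.
by move: m'f; rewrite e mcoeff_msupp c0 eqxx.
Qed.

Lemma supp_leM m m' f g :
  supp_le m f -> supp_le m' g -> supp_le (m + m')%MM (f * g).
Proof.
move=> Hf Hg k /msuppM_le /allpairsP[[k1 k2] /= [/Hf h1 /Hg h2 ->]].
exact: grevlex_leD.
Qed.

Lemma supp_ltM m m' f g :
  supp_lt m f -> supp_le m' g -> supp_lt (m + m')%MM (f * g).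
Proof.
move=> Hf Hg k /msuppM_le /allpairsP[[k1 k2] /= [/Hf h1 /Hg h2 ->]].
exact: grevlex_ltleD.
Qed.

Lemma supp_lt_rem m f : supp_le m f -> supp_lt m (f - f@_m *: 'X_[m]).
Proof.
move=> Hf; apply: supp_ltP; last first.
  by rewrite mcoeffB mcoeffZ mcoeffX eqxx mulr1 subrr.
rewrite -scaleN1r; apply: supp_leD => //.
by do 2!apply: supp_leZ; apply: supp_leX.
Qed.

Lemma mcoeffM_lead m m' f g : supp_le m f -> supp_le m' g ->
  (f * g)@_(m + m')%MM = f@_m * g@_m'.
Proof.
move=> Hf Hg; have rf := supp_lt_rem Hf; have rg := supp_lt_rem Hg.
set f1 := (f - _) in rf; set g1 := (g - _) in rg.
(* Both lead terms are split off. Each of the first two summands has a factor supported strictly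
   below its bound, so only the last one contributes at [m + m']. *)
have -> : f * g = f1 * g + f@_m *: (g1 * 'X_[m]) + (f@_m * g@_m') *: 'X_[m + m'].
  rewrite /f1 /g1 mpolyXD -!mul_mpolyC mpolyCM; ring.
rewrite !mcoeffD !mcoeffZ mcoeffX eqxx mulr1.
rewrite (supp_lt_coef0 (supp_ltM rf Hg)) add0r addmC.
by rewrite (supp_lt_coef0 (supp_ltM rg (supp_leX (m := m)))) mulr0 add0r.
Qed.

(** [c] may be zero, and then [m] only bounds the support; this makes the predicate multiplicative
    without side conditions. *)
Definition has_lead f m (c : F) := supp_le m f /\ f@_m = c.

Lemma has_lead1 : has_lead 1 0%MM 1.
Proof.
split; last by rewrite mcoeff1 eqxx.
by rewrite -mpolyX0; apply: supp_leX.
Qed.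

Lemma has_leadM f g m m' c c' :
  has_lead f m c -> has_lead g m' c' -> has_lead (f * g) (m + m')%MM (c * c').
Proof.
case=> Hf <- [Hg <-]; split; [exact: supp_leM | exact: mcoeffM_lead].
Qed.

Lemma has_leadXn f m c k :
  has_lead f m c -> has_lead (f ^+ k) (m *+ k)%MM (c ^+ k).
Proof.
move=> H; elim: k => [|k IHk]; first by rewrite !expr0 mulm0n; apply: has_lead1.
by rewrite !exprS mulmS; apply: has_leadM.
Qed.

Lemma has_lead_prod (I : finType) (G : I -> {mpoly F[3]}) m :
  (forall i, has_lead (G i) m 1) -> has_lead (\prod_i G i) (m *+ #|I|)%MM 1.
Proof.
move=> H; rewrite cardE -big_enum; elim: (enum I) => [|i s IHs].
  by rewrite big_nil mulm0n; apply: has_lead1.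
by rewrite big_cons mulmS -[X in has_lead _ _ X]mulr1; apply: has_leadM.
Qed.

Lemma is_lead_monP f m :
  reflect (supp_le m f /\ f@_m != 0) (is_lead_mon f m).
Proof.
rewrite /is_lead_mon mcoeff_msupp; apply: (iffP andP).
  by case=> nz /allP H; split.
by case=> H nz; split=> //; apply/allP => m' /H.
Qed.

Lemma is_lead_mon_uniq f m m' : is_lead_mon f m -> is_lead_mon f m' -> m = m'.
Proof.
case/is_lead_monP=> Hm nm /is_lead_monP[Hm' nm'].
rewrite -!mcoeff_msupp in nm nm'.
case/orP: (Hm' _ nm) => [/eqP //|lt]; case/orP: (Hm _ nm') => [/eqP //|lt'].
by have := grevlex_trans lt lt'; rewrite grevlex_irr.
Qed.

Lemma is_lead_monM f g m m' :
  is_lead_mon f m -> is_lead_mon g m' -> is_lead_mon (f * g) (m + m')%MM.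
Proof.
move=> /is_lead_monP[Hf nf] /is_lead_monP[Hg ng]; apply/is_lead_monP; split.
  exact: supp_leM.
by rewrite mcoeffM_lead // mulf_neq0.
Qed.

Lemma is_lead_monXn f m k :
  is_lead_mon f m -> is_lead_mon (f ^+ k) (m *+ k)%MM.
Proof.
move=> H; elim: k => [|k IHk]; last by rewrite exprS mulmS; apply: is_lead_monM.
have [h c] := has_lead1; apply/is_lead_monP.
by rewrite expr0 mulm0n c oner_neq0.
Qed.

Lemma has_lead_monomial_add m f :
  supp_lt m f -> has_lead ('X_[m] + f) m 1.
Proof.
move=> lt; split; first by apply/supp_leD; [apply: supp_leX | apply: supp_ltW].
by rewrite mcoeffD mcoeffX eqxx (supp_lt_coef0 lt) addr0.
Qed.

Lemma has_lead_is_lead_mon f m c :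
  c != 0 -> has_lead f m c -> is_lead_mon f m.
Proof. by move=> c0 [H E]; apply/is_lead_monP; rewrite E. Qed.

End Leading.

(** * Normal forms, their lead monomials and their subduction *)

Section NormalForms.

Variables (F : fieldType) (q : nat) (b : 4.-tuple {mpoly F[3]}).

Lemma ord4P (P : 'I_4 -> Prop) : P 0 -> P 1 -> P 2 -> P 3 -> forall i, P i.
Proof.
move=> P0 P1 P2 P3 [[|[|[|[|i]]]] Hi] //;
  [move: P0|move: P1|move: P2|move: P3]; by congr P; apply: val_inj.
Qed.

Lemma mnm4_eq (I J : 'X_{1..4}) :
  I 0 = J 0 -> I 1 = J 1 -> I 2 = J 2 -> I 3 = J 3 -> I = J.
Proof. by move=> *; apply/mnmP; apply: ord4P. Qed.

Lemma big_ord4 (R : pzSemiRingType) (G : 'I_4 -> R) :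
  \prod_(i < 4) G i = G 0 * G 1 * G 2 * G 3.
Proof.
rewrite !big_ord_recl big_ord0 mulr1 !mulrA.
by congr (G _ * G _ * G _ * G _); apply: val_inj.
Qed.

(* The lead monomial of 'X_[I] \mPo b, where b has the lead monomials
   x, y^2, y^q, z^q. *)
Definition lead_exponent (I : 'X_{1..4}) : 'X_{1..3} :=
  (U_(0%R) *+ I 0%R + U_(1%R) *+ (2 * I 1%R + q * I 2%R)
   + U_(2%R) *+ (q * I 3%R))%MM.

Lemma lead_exponentE I : [/\ lead_exponent I 0 = I 0%R,
  lead_exponent I 1 = (2 * I 1%R + q * I 2%R)%N
  & lead_exponent I 2 = (q * I 3%R)%N].
Proof. by split; rewrite /lead_exponent !mnmDE !mulmnE !mnm1E /=; lia. Qed.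

(* The relation being quadratic in X_2, one may ask for degree at most 1 in X_2;
   as q is odd, the parity of the exponent of y then determines I 2. *)
Definition normal_form (h : {mpoly F[4]}) :=
  forall I, I \in msupp h -> (I 2%R <= 1)%N.

Hypothesis q_odd : odd q.
Hypothesis lead0 : is_lead_mon (tnth b 0) U_(0).
Hypothesis lead1 : is_lead_mon (tnth b 1) (U_(1) *+ 2).
Hypothesis lead2 : is_lead_mon (tnth b 2) (U_(1) *+ q).
Hypothesis lead3 : is_lead_mon (tnth b 3) (U_(2) *+ q).

Lemma lead_exponent_inj (I J : 'X_{1..4}) : (I 2%R <= 1)%N -> (J 2%R <= 1)%N ->
  lead_exponent I = lead_exponent J -> I = J.
Proof.
move=> I2 J2 /mnmP e; have q_gt0 : (0 < q)%N by case: (q) q_odd.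
have [e0 e1 e2] := lead_exponentE I; have [f0 f1 f2] := lead_exponentE J.
move: (e 0) (e 1) (e 2); rewrite e0 e1 e2 f0 f1 f2 => {e e0 e1 e2 f0 f1 f2} g0 g1 g2.
have g3 : I 3%R = J 3%R by apply/eqP; rewrite -(eqn_pmul2l q_gt0); apply/eqP.
have g4 : I 2%R = J 2%R.
  have := congr1 odd g1; rewrite !mul2n !oddD !odd_double !oddM q_odd.
  by move: (I 2%R) (J 2%R) I2 J2 => [|[|i]] [|[|j]].
apply: mnm4_eq => //; rewrite g4 in g1; lia.
Qed.

Lemma is_lead_mon_monomial I :
  is_lead_mon ('X_[I] \mPo b) (lead_exponent I).
Proof.
rewrite comp_mpolyX big_ord4.
have -> : lead_exponent I = (U_(0%R) *+ I 0%R + (U_(1%R) *+ 2) *+ I 1%R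
   + (U_(1%R) *+ q) *+ I 2%R + (U_(2%R) *+ q) *+ I 3%R)%MM.
  by apply/mnmP => i; rewrite !mnmDE !mulmnE; lia.
by do !apply: is_lead_monM; apply: is_lead_monXn.
Qed.

Lemma grevlex_max (s : seq 'X_{1..4}) : s != [::] ->
  exists2 I, I \in s & forall J, J \in s ->
    grevlex_le (lead_exponent J) (lead_exponent I).
Proof.
elim: s => [//|I s IHs] _; case: (eqVneq s [::]) => [->|/IHs[J Js HJ]].
  exists I; rewrite ?inE // => J; rewrite inE => /eqP ->.
  exact: grevlex_le_refl.
have [le|] := boolP (grevlex_le (lead_exponent I) (lead_exponent J)).
  exists J; rewrite ?inE ?Js ?orbT // => K; rewrite inE => /orP[/eqP -> //|].
  exact: HJ.
rewrite /grevlex_le negb_or => /andP[ne /negbTE nlt].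
have := grevlex_total ne; rewrite nlt /= => lt.
exists I; rewrite ?inE ?eqxx // => K; rewrite inE => /orP[/eqP ->|/HJ le].
  exact: grevlex_le_refl.
by rewrite /grevlex_le (grevlex_le_lt_trans le lt) orbT.
Qed.

(** Distinct normal monomials have distinct lead exponents, so the largest lead exponent on the
    support of [h] is attained once and cannot cancel. *)
Lemma normal_form_lead h : normal_form h -> h != 0 ->
  exists2 I, I \in msupp h &
    is_lead_mon (h \mPo b) (lead_exponent I) /\
    same_lead_term (h \mPo b) (h@_I *: ('X_[I] \mPo b)).
Proof.
move=> nh h0; have [|I Ih Imax] := @grevlex_max (msupp h).
  by rewrite msupp_eq0.
have /is_lead_monP[leI cI] := is_lead_mon_monomial I.
have cIh : h@_I != 0 by rewrite -mcoeff_msupp.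
set e := lead_exponent I in leI cI *.
have hE : h \mPo b = h@_I *: ('X_[I] \mPo b)
    + ((h - h@_I *: 'X_[I]) \mPo b) by rewrite comp_mpolyB comp_mpolyZ addrC subrK.
have rest : supp_lt e ((h - h@_I *: 'X_[I]) \mPo b).
  rewrite comp_mpolyE big_seq; elim/big_ind: _ => [||J].
  - exact: supp_lt0.
  - by move=> f g; apply: supp_ltD.
  rewrite (perm_mem (msupp_rem _ _)) mem_rem_uniq ?msupp_uniq // => /andP[neJ Jh].
  rewrite -comp_mpolyX; apply: supp_ltZ.
  have /is_lead_monP[leJ _] := is_lead_mon_monomial J.
  apply: supp_le_lt leJ _; case/orP: (Imax J Jh) => // /eqP eJ.
  by case/eqP: neJ; apply: lead_exponent_inj eJ; apply: nh.
have coefE : (h \mPo b)@_e = h@_I * ('X_[I] \mPo b)@_e.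
  by rewrite hE mcoeffD mcoeffZ (supp_lt_coef0 rest) addr0.
have leadh : is_lead_mon (h \mPo b) e.
  apply/is_lead_monP; rewrite coefE mulf_neq0 //; split=> //.
  by rewrite hE; apply/supp_leD; [apply: supp_leZ|apply: supp_ltW].
exists I => //; split=> //; exists e; rewrite mcoeffZ coefE; split=> //.
by apply/is_lead_monP; rewrite mcoeffZ mulf_neq0 //; split=> //; apply: supp_leZ.
Qed.

Lemma normal_form_eq0 h : normal_form h -> h \mPo b = 0 -> h = 0.
Proof.
move=> nh h0; apply/eqP/contraT => /(normal_form_lead nh)[I _ [/is_lead_monP[_]]].
by rewrite h0 mcoeff0 eqxx.
Qed.

Lemma normal_form_rem h I : normal_form h -> normal_form (h - h@_I *: 'X_[I]).
Proof. by move=> nh J; rewrite (perm_mem (msupp_rem _ _)) => /mem_rem/nh. Qed.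

(** Subtracting the product that carries the lead term removes exactly one monomial of [h] and
    leaves a normal form, so the run ends after as many steps as [h] has monomials. *)
Lemma normal_form_subducts h : normal_form h -> subducts_to_zero b (h \mPo b) h.
Proof.
move: {2}(size (msupp h)) (leqnn (size (msupp h))) => k.
elim: k h => [|k IHk] h.
  rewrite leqn0 size_eq0 msupp_eq0 => /eqP -> _.
  by rewrite comp_mpoly0; apply: Subduct_done.
move=> szh nh; have [->|/(normal_form_lead nh)[I Ih [_ slt]]] := eqVneq h 0.
  by rewrite comp_mpoly0; apply: Subduct_done.
(* Only the recorded polynomial is split into lead term and rest; the polynomial being subducted is
   left alone. *)
have -> : subducts_to_zero b (h \mPo b) h = subducts_to_zero b (h \mPo b)
   (h@_I *: 'X_[I] + (h - h@_I *: 'X_[I])) by rewrite addrC subrK.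
apply: Subduct_step => //; rewrite -comp_mpolyZ -comp_mpolyB.
apply: IHk; last exact: normal_form_rem.
by rewrite (perm_size (msupp_rem _ _)) size_rem //; case: size szh.
Qed.

Lemma subduction_comp f h : subducts_to_zero b f h -> h \mPo b = f.
Proof.
elim=> [|{}f c I h' _ _ IHh]; first by rewrite comp_mpoly0.
by rewrite comp_mpolyD comp_mpolyZ IHh addrC subrK.
Qed.

(** Each step subtracts a multiple of a product whose lead monomial lies in the support of the
    current polynomial, so the bound [m] persists along the whole run, whichever products are
    chosen. *)
Lemma subduction_exponents f h m : subducts_to_zero b f h -> supp_lt m f ->
  forall I, I \in msupp h -> grevlex_lt (lead_exponent I) m.
Proof.
elim=> [|{}f c I h' [m' [lf lg _]] _ IHh] Hf J; first by rewrite msupp0.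
have [le' c'] := is_lead_monP _ _ lg; have [lef cf] := is_lead_monP _ _ lf.
have c0 : c != 0 by apply: contraNneq c' => ->; rewrite scale0r mcoeff0.
have lt'm : grevlex_lt m' m by apply: Hf; rewrite mcoeff_msupp.
have em : m' = lead_exponent I.
  apply: is_lead_mon_uniq (is_lead_mon_monomial I); apply/is_lead_monP.
  move: c'; rewrite mcoeffZ mulf_eq0 (negbTE c0) => c'; split=> // k kX.
  by apply: le'; rewrite mcoeff_msupp mcoeffZ mulf_neq0 -?mcoeff_msupp.
move=> /msuppD_le; rewrite mem_cat => /orP[/msuppZ_le|].
  by rewrite msuppX inE => /eqP ->; rewrite -em.
by apply: IHh; apply: supp_ltB => //; apply: supp_le_lt le' lt'm.
Qed.

End NormalForms.

(** * Division by a relation quadratic in [X_2] *)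

Section Division.

Variables (F : fieldType) (r : {mpoly F[4]}) (c : F).
Hypothesis c_neq0 : c != 0.
Hypothesis r_lead : normal_form (r - c *: 'X_2 ^+ 2).

Lemma normal_form0 : normal_form (0 : {mpoly F[4]}).
Proof. by move=> I; rewrite msupp0. Qed.

Lemma normal_formD (h h' : {mpoly F[4]}) :
  normal_form h -> normal_form h' -> normal_form (h + h').
Proof. by move=> nh nh' I /msuppD_le; rewrite mem_cat => /orP[/nh|/nh']. Qed.

Lemma normal_formZ a (h : {mpoly F[4]}) : normal_form h -> normal_form (a *: h).
Proof. by move=> nh I /msuppZ_le/nh. Qed.

Lemma normal_form_division (h : {mpoly F[4]}) :
  exists u h', h = u * r + h' /\ normal_form h'.
Proof.
pose D (h : {mpoly F[4]}) := exists u h', h = u * r + h' /\ normal_form h'.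
have D0 : D 0 by exists 0, 0; rewrite mul0r addr0; split=> //; apply: normal_form0.
have DD h1 h2 : D h1 -> D h2 -> D (h1 + h2).
  case=> u1 [n1 [-> N1]] [u2 [n2 [-> N2]]]; exists (u1 + u2), (n1 + n2).
  by split; [ring | apply: normal_formD].
have DZ a h1 : D h1 -> D (a *: h1).
  case=> u1 [n1 [-> N1]]; exists (a *: u1), (a *: n1).
  by split; [rewrite scalerDr scalerAl | apply: normal_formZ].
(* Induction on a bound [k] for the degree in [X_2]; the bounds 0 and 1 already describe normal
   forms. *)
suff H k g : (forall I : 'X_{1..4}, I \in msupp g -> (I 2%R <= k)%N) -> D g.
  apply: (H (msize h)) => I /msize_mdeg_lt; rewrite mdegE.
  by rewrite (bigD1 (2%R : 'I_4)) //=; lia.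
elim: k g => [|k IHk] g Hg.
  exists 0, g; rewrite mul0r add0r; split=> // I /Hg; lia.
case: k IHk Hg => [|k] IHk Hg; first by exists 0, g; rewrite mul0r add0r.
rewrite (mpolyE g) big_seq; elim/big_ind: _ => // I /Hg; rewrite leq_eqVlt.
move=> /orP[/eqP eI|ltI]; last first.
  by apply/DZ/IHk => J; rewrite msuppX inE => /eqP ->.
apply: (DZ); pose J : 'X_{1..4} := (I - U_(2%R) *+ 2)%MM.
(* One factor [X_2^2] is rewritten by means of [r]. Since [r - c X_2^2] has degree at most 1 in
   [X_2], the second term has smaller degree in [X_2] than [X_[I]]. *)
have -> : 'X_[I] = (c^-1 *: 'X_[J]) * r
    - c^-1 *: ((r - c *: 'X_2 ^+ 2) * 'X_[J]).
  rewrite mulrBl scalerBr -!scalerAl scalerA mulVf // scale1r.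
  rewrite [r * _]mulrC subKr mpolyXn -mpolyXD addmC submK //.
  by apply/mnm_lepP => i; rewrite mulmnE mnm1E; case: eqP => [<-|] //; rewrite eI.
apply: DD; first by exists (c^-1 *: 'X_[J]), 0; rewrite addr0; split;
  last exact: normal_form0.
rewrite -scalerN -scaleN1r; apply: (DZ); apply: (DZ); apply: IHk => K.
rewrite mulrC => /msuppM_le /allpairsP[[K1 K2] /= []]; rewrite msuppX inE.
move=> /eqP -> /r_lead; rewrite /J => le1 ->.
by rewrite mnmDE mnmBE mulmnE mnm1E eqxx eI; lia.
Qed.

End Division.

(** * Additive polynomials attached to one or two generators over the prime field *)

Section AdditivePolynomials.

Variable p : nat.

Lemma natr_inj_pchar (R : nzRingType) (i j : nat) : p \in [pchar R] ->
  (i < p)%N -> (j < p)%N -> i%:R = j%:R :> R -> i = j.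
Proof.
move=> pR; wlog le_ji : i j / (j <= i)%N.
  by move=> H ip jp e; case/orP: (leq_total i j) => le; [symmetry|]; apply: H.
move=> ip _ /eqP; rewrite -subr_eq0 -natrB // -(dvdn_pcharf pR).
case: (posnP (i - j)) => [|lt /(dvdn_leq lt)]; lia.
Qed.

Lemma natr_Zp_inj (R : nzRingType) (i j : 'Z_p) : p \in [pchar R] ->
  (i : nat)%:R = (j : nat)%:R :> R -> i = j.
Proof.
move=> pR e; have p1 := prime_gt1 (pcharf_prime pR).
apply: val_inj; apply: natr_inj_pchar pR _ _ e;
  by rewrite -[X in (_ < X)%N](Zp_cast p1).
Qed.

(** For nonzero [a] in a field of characteristic p, this is the monic additive polynomial whose
    roots are the multiples of [a] by the prime field. *)
Definition additive_step (R : pzRingType) (a Y : R) := Y ^+ p - a ^+ p.-1 * Y.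

Lemma additive_stepD (R : comNzRingType) (a Y Z : R) : p \in [pchar R] ->
  additive_step a (Y + Z) = additive_step a Y + additive_step a Z.
Proof.
move=> pR; rewrite /additive_step mulrDr -!(pFrobenius_autE pR).
by rewrite pFrobenius_autD_comm; [ring | apply: mulrC].
Qed.

Lemma additive_stepMn (R : comNzRingType) (a Y : R) k : p \in [pchar R] ->
  additive_step a (Y *+ k) = additive_step a Y *+ k.
Proof.
move=> pR; elim: k => [|k IHk]; last by rewrite !mulrS additive_stepD // IHk.
have p0 := prime_gt0 (pcharf_prime pR).
by rewrite /additive_step !mulr0n mulr0 subr0 expr0n; case: (p) p0.
Qed.

Lemma additive_stepB (R : comNzRingType) (a Y Z : R) : p \in [pchar R] ->
  additive_step a (Y - Z) = additive_step a Y - additive_step a Z.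
Proof.
by move=> pR; rewrite -{2}[Y](subrK Z) (additive_stepD _ (Y - Z)) // addrK.
Qed.

Lemma rmorph_additive_step (R S : pzRingType) (f : {rmorphism R -> S}) a Y :
  f (additive_step a Y) = additive_step (f a) (f Y).
Proof. by rewrite /additive_step rmorphB rmorphM !rmorphXn. Qed.

(** For nonzero [a], the p distinct elements [- (a *+ i)] are roots of a monic polynomial of degree
    p, which therefore splits. For [a = 0] both sides are [Y ^+ p]. *)
Lemma prod_additive_step_field (K : fieldType) (a Y : K) : p \in [pchar K] ->
  \prod_(i : 'Z_p) (Y + a *+ i) = additive_step a Y.
Proof.
move=> pK; have p1 := prime_gt1 (pcharf_prime pK).
have [->|a0] := eqVneq a 0.
  rewrite /additive_step expr0n -(prednK (ltnW p1)) /=.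
  have -> : (p.-1 == 0)%N = false by lia.
  rewrite mul0r subr0 prednK 1?ltnW // (eq_bigr (fun=> Y)) => [|i _].
    by rewrite prodr_const card_ord Zp_cast.
  by rewrite mul0rn addr0.
pose P : {poly K} := 'X^p - (a ^+ p.-1)%:P * 'X.
pose rs := [seq - (a *+ i) | i : 'Z_p <- enum 'Z_p].
have szP : size P = p.+1.
  rewrite /P size_polyDl ?size_polyXn // size_polyN mul_polyC.
  by rewrite (leq_ltn_trans (size_scale_leq _ _)) ?size_polyX.
have lcP : lead_coef P = 1.
  rewrite lead_coefE szP /P coefB coefXn eqxx coefCM coefX.
  by rewrite (gtn_eqF p1) mulr0 subr0.
have -> : additive_step a Y = P.[Y] by rewrite !hornerE.
have -> : P = \prod_(z <- rs) ('X - z%:P).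
  rewrite [LHS](@all_roots_prod_XsubC _ _ rs) ?lcP ?scale1r //.
  - by rewrite szP size_map -cardE card_ord Zp_cast.
  - apply/allP=> _ /mapP[i _ ->]; rewrite rootE !hornerE.
    (* Frobenius is additive, hence commutes with the integer multiple [i]. *)
    have E : (- (a *+ i)) ^+ p = - (a ^+ p *+ i).
      rewrite -(pFrobenius_autE pK) pFrobenius_autN pFrobenius_autMn.
      by rewrite pFrobenius_autE.
    by rewrite E mulrN opprK mulrnAr -exprSr prednK 1?ltnW // addNr.
  rewrite uniq_rootsE map_inj_uniq ?enum_uniq // => i j /oppr_inj/eqP.
  rewrite -![a *+ _]mulr_natr -subr_eq0 -mulrBr mulf_eq0 (negbTE a0) subr_eq0.
  by move/eqP/(natr_Zp_inj pK).
rewrite horner_prod big_map big_enum /=; apply: eq_bigr => i _.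
by rewrite !hornerE opprK.
Qed.

(** Counting roots requires a field, so the identity is pulled back from the field of fractions; it
    is later applied to polynomial rings. *)
Lemma prod_additive_step (R : idomainType) (a Y : R) : p \in [pchar R] ->
  \prod_(i : 'Z_p) (Y + a *+ i) = additive_step a Y.
Proof.
move=> pR; pose iota : {rmorphism R -> {fraction R}} := @FracField.tofrac R.
apply/eqP; rewrite -tofrac_eq; apply/eqP.
rewrite -[RHS]/(iota _) -[LHS]/(iota _) rmorph_additive_step rmorph_prod /=.
rewrite -prod_additive_step_field ?(rmorph_pchar iota pR) //.
by apply: eq_bigr => i _; rewrite rmorphD rmorphMn.
Qed.

(** The inner step kills the line of [a0] and sends [a1] to a generator of the image of the plane;
    the outer step kills the line of that image. *)
Definition additive_poly (R : pzRingType) (a0 a1 Y : R) :=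
  additive_step (additive_step a0 a1) (additive_step a0 Y).

Lemma additive_polyB (R : comNzRingType) (a0 a1 Y Z : R) : p \in [pchar R] ->
  additive_poly a0 a1 (Y - Z) = additive_poly a0 a1 Y - additive_poly a0 a1 Z.
Proof. by move=> pR; rewrite /additive_poly !additive_stepB. Qed.

Lemma rmorph_additive_poly (R S : pzRingType) (f : {rmorphism R -> S}) a0 a1 Y :
  f (additive_poly a0 a1 Y) = additive_poly (f a0) (f a1) (f Y).
Proof. by rewrite /additive_poly !rmorph_additive_step. Qed.

(** Multiplying over the coefficient of [a0] first gives the inner step at [Y + a1 *+ j]. By
    additivity this is again a progression in [j], and the product over [j] is the outer step. *)
Lemma prod_additive_poly (R : idomainType) (a0 a1 Y : R) : p \in [pchar R] ->
  \prod_(g : 'Z_p * 'Z_p) (Y + (a0 *+ g.1 + a1 *+ g.2)) = additive_poly a0 a1 Y.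
Proof.
move=> pR; rewrite -(pair_bigA _ (fun i j : 'Z_p => Y + (a0 *+ i + a1 *+ j))) /=.
rewrite exchange_big /= /additive_poly -prod_additive_step //.
apply: eq_bigr => j _; rewrite -additive_stepMn // -additive_stepD //.
by rewrite -prod_additive_step //; apply: eq_bigr => i _; ring.
Qed.

End AdditivePolynomials.

(** * Products of quadratic norms as 2 by 2 determinants *)

Lemma det2 (R : comPzRingType) (A : 'M[R]_2) :
  \det A = A 0 0 * A 1 1 - A 0 1 * A 1 0.
Proof.
rewrite (expand_det_row _ 0) !big_ord_recl big_ord0 /cofactor !det_mx11 !mxE /=.
rewrite expr0 expr1 mul1r addr0 mulN1r mulrN.
by congr (_ * A _ _ - A _ _ * A _ _); apply: val_inj.
Qed.

Section NormRelation.

Variable p : nat.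

Definition companion2 (R : pzRingType) (s D : R) : 'M[R]_2 :=
  \matrix_(i, j) if i == 0 then (if j == 0 then 0 else D)
                 else (if j == 0 then 1 else s).

Definition additive_mx (R : comNzRingType) (a0 a1 s D : R) : 'M[R]_2 :=
  horner_mx (companion2 s D) (additive_poly p a0%:P a1%:P 'X).

(** Allows the matrix to be formed once with variables as entries and then evaluated at the
    generators. *)
Lemma map_additive_mx (R S : comNzRingType) (f : {rmorphism R -> S}) a0 a1 s D :
  map_mx f (additive_mx a0 a1 s D) = additive_mx (f a0) (f a1) (f s) (f D).
Proof.
rewrite /additive_mx map_horner_mx rmorph_additive_poly /= !map_polyC map_polyX.
congr horner_mx; apply/matrixP=> i j; rewrite !mxE.
by do 2!case: ifP => _; rewrite ?rmorph0 ?rmorph1.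
Qed.

(* With C the companion matrix of T^2 - s T - D, each factor is the norm
   \det (u - C), and the product over g of the commuting matrices u - C is
   L (Y - C) = L Y - L C for the additive polynomial L. *)
Lemma prod_norm (R : idomainType) (a0 a1 s D Y : R) : p \in [pchar R] ->
  \prod_(g : 'Z_p * 'Z_p)
    (let u := Y + (a0 *+ g.1 + a1 *+ g.2) in u ^+ 2 - s * u - D) =
  \det ((additive_poly p a0 a1 Y)%:M - additive_mx a0 a1 s D).
Proof.
move=> pR; pose C := companion2 s D.
have pP : p \in [pchar {poly R}] by apply: (rmorph_pchar polyC).
rewrite (eq_bigr (fun g : 'Z_p * 'Z_p => \det (horner_mx C
  (Y%:P - 'X + (a0%:P *+ g.1 + a1%:P *+ g.2))))) => [|g _]; last first.
  rewrite -!polyCMn -!polyCD addrAC -polyCD rmorphB /= horner_mx_C horner_mx_X.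
  rewrite det2 !mxE /= !mulr1n !mulr0n; ring.
(* Evaluation at [C] followed by the determinant is multiplicative, so the product can be computed
   on polynomials in [C]. *)
rewrite -[LHS](big_morph (fun q => \det (horner_mx C q)) (op1 := *%R) (id1 := 1)
    (op2 := *%R) (id2 := 1)).
- rewrite prod_additive_poly // additive_polyB // rmorphB /=.
  by rewrite -(rmorph_additive_poly _ (@polyC R)) horner_mx_C.
- by move=> q r; rewrite rmorphM /= det_mulmx.
by rewrite rmorph1 det1.
Qed.

End NormRelation.

(** * A relation among the generators, monic and quadratic in [X_2] *)

Section Relation.

Variables (F : fieldType) (p : nat) (a0 a1 lam gam : F).
Hypothesis pF : p \in [pchar F].

Definition translation (g : 'Z_p * 'Z_p) : F := a0 *+ g.1 + a1 *+ g.2.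

Definition norm_y : {mpoly F[3]} :=
  \prod_(g : 'Z_p * 'Z_p) (y F + translation g *: x F).

Definition norm_z : {mpoly F[3]} :=
  \prod_(g : 'Z_p * 'Z_p) (z F + (2%:R * translation g) *: y F
    + (translation g ^+ 2 + lam * translation g) *: x F).

Definition quadratic_inv : {mpoly F[3]} := delta F + lam *: (y F * x F).

Definition normalized_generators : 4.-tuple {mpoly F[3]} :=
  [tuple x F; gam *: quadratic_inv; norm_y; norm_z].

Local Notation b := normalized_generators.

Lemma card_ZpZp : #|{: 'Z_p * 'Z_p}| = (p ^ 2)%N.
Proof.
by rewrite card_prod card_ord Zp_cast ?mulnn // prime_gt1 ?(pcharf_prime pF).
Qed.

Lemma pchar_mpoly n : p \in [pchar {mpoly F[n]}].
Proof. exact: (rmorph_pchar (@mpolyC n F)). Qed.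

(* The polynomials fixed by this substitution are those free of X_2. *)
Definition forget2 : 4.-tuple {mpoly F[4]} := [tuple 'X_0; 'X_1; 0; 'X_3].

Lemma msupp_forget2 (h : {mpoly F[4]}) I :
  I \in msupp (h \mPo forget2) -> I 2%R = 0%N.
Proof.
rewrite comp_mpolyE => /msupp_sum_le /flatten_mapP[J _ /msuppZ_le].
rewrite big_ord4 !(tnth_nth 0) /=.
have [->|J2] := eqVneq (J 2%R) 0%N; last first.
  by rewrite expr0n (negbTE J2) mulr0 mul0r msupp0.
rewrite expr0 mulr1 !mpolyXn -!mpolyXD msuppX inE => /eqP ->.
by rewrite !mnmDE !mulmnE !mnm1E.
Qed.

(* x^(p^2) N(z) is the product of the norms of [prod_norm] for s = - lam x and
   D = quadratic_inv, because x (z . g) = u^2 + lam x u - D with u = y . g. *)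
Lemma exists_relation : gam != 0 ->
  exists r, r \mPo b = 0 /\ normal_form (r - 1 *: 'X_2 ^+ 2).
Proof.
move=> gam0; pose T := {mpoly F[4]}.
(* [E] is L(C) in the variables: [X_0] stands for [x], and [gam^-1 X_1] for [quadratic_inv], the
   second generator being [gam] times it. *)
pose E : 'M[T]_2 := additive_mx p (a0 *: 'X_0) (a1 *: 'X_0)
  (- (lam *: 'X_0)) (gam^-1 *: 'X_1).
exists (\det (('X_2)%:M - E) - 'X_0 ^+ (p ^ 2) * 'X_3); split.
  pose ev : {rmorphism T -> {mpoly F[3]}} := comp_mpoly b.
  rewrite -[LHS]/(ev _) rmorphB /= -det_map_mx map_mxB map_scalar_mx /=.
  rewrite map_additive_mx /= rmorphM rmorphXn rmorphN /=.
  rewrite !comp_mpolyZ !comp_mpolyXU /=.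
  rewrite scalerA mulVf // scale1r.
  have -> : norm_y = additive_poly p (a0 *: x F) (a1 *: x F) (y F).
    rewrite -prod_additive_poly ?pchar_mpoly //; apply: eq_bigr => g _.
    by rewrite /translation scalerDl -!scalerMnl.
  rewrite -prod_norm ?pchar_mpoly // /norm_z -card_ZpZp -prodr_const -big_split.
  apply/eqP; rewrite subr_eq0; apply/eqP/eq_bigr => g _ /=.
  rewrite !scalerMnl -scalerDl -/(translation g) /quadratic_inv /delta.
  by rewrite -!mul_mpolyC !(rmorphD, rmorphM, rmorphXn) /=; ring.
(* The entries of [E] are free of [X_2], so the determinant is X_2^2 - tr(E) X_2 + det(E), with
   trace and determinant free of [X_2]. *)
pose kp : {rmorphism T -> T} := comp_mpoly forget2.
have kE i j : E i j \mPo forget2 = E i j.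
  have : map_mx kp E = E.
    by rewrite map_additive_mx /= rmorphN /= !comp_mpolyZ !comp_mpolyXU.
  by move/matrixP/(_ i j); rewrite mxE.
have -> : \det (('X_2)%:M - E) - 'X_0 ^+ (p ^ 2) * 'X_3 - 1 *: 'X_2 ^+ 2 =
    (E 0 0 * E 1 1 - E 0 1 * E 1 0 - 'X_0 ^+ (p ^ 2) * 'X_3) -
    (E 0 0 + E 1 1) * 'X_2.
  by rewrite det2 !mxE /= !mulr1n !mulr0n scale1r; ring.
move=> I /msuppB_le; rewrite mem_cat => /orP[].
  set f := (X in msupp X); suff <- : f \mPo forget2 = f by move/msupp_forget2 ->.
  rewrite -[LHS]/(kp _) !rmorphB !rmorphM rmorphXn /= !kE !comp_mpolyXU.
  by rewrite /= /f.
move=> /msuppM_le /allpairsP[[J K] /= []].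
set f := (X in msupp X); have <- : f \mPo forget2 = f.
  by rewrite /f comp_mpolyD !kE.
move/msupp_forget2 => J2; rewrite msuppX inE => /eqP -> ->.
by rewrite mnmDE J2 mnm1E.
Qed.

End Relation.

Lemma big_ord3 (R : pzSemiRingType) (G : 'I_3 -> R) :
  \prod_(i < 3) G i = G 0 * G 1 * G 2.
Proof.
rewrite !big_ord_recl big_ord0 mulr1 !mulrA.
by congr (G _ * G _ * G _); apply: val_inj.
Qed.

(** * Composition and congruence of substitutions *)

Section Composition.

Lemma comp_mpolyA (R : comNzRingType) (n k l : nat) (s : n.-tuple {mpoly R[k]})
    (s' : k.-tuple {mpoly R[l]}) (f : {mpoly R[n]}) :
  (f \mPo s) \mPo s' = f \mPo [tuple of [seq g \mPo s' | g <- s]].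
Proof.
elim/mpolyind: f => [|c m f _ _ IHf]; first by rewrite !comp_mpoly0.
rewrite !comp_mpolyD {}IHf !comp_mpolyZ; congr (_ *: _ + _).
rewrite !comp_mpolyX rmorph_prod /=; apply: eq_bigr => i _.
by rewrite rmorphXn /= tnth_map.
Qed.

(** Modulo [a] the substitution is the identity. With [a] linear in [y] this yields the factor
    theorem. *)
Lemma comp_mpoly_mod (R : comNzRingType) (n : nat) (s : n.-tuple {mpoly R[n]})
    (a f : {mpoly R[n]}) :
  (forall i, exists q, tnth s i = 'X_i + a * q) ->
  exists q, f \mPo s = f + a * q.
Proof.
move=> Hs; elim/mpolyind: f => [|c m f _ _ [q IHf]].
  by exists 0; rewrite comp_mpoly0 mulr0 addr0.
suff [q' E] : exists q, 'X_[m] \mPo s = 'X_[m] + a * q.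
  exists (c *: q' + q); rewrite comp_mpolyD comp_mpolyZ IHf E -!mul_mpolyC; ring.
rewrite comp_mpolyX mpolyXE_id.
elim/big_ind2: _ => [|u u' v v' [q1 ->] [q2 ->]|i _].
- by exists 0; rewrite mulr0 addr0.
- by exists (u * q2 + v * q1 + a * q1 * q2); ring.
have [q0 ->] := Hs i; elim: (m i) => [|k [q1 E]].
  by exists 0; rewrite mulr0 addr0.
by exists ('X_i * q1 + 'X_i ^+ k * q0 + a * q0 * q1); rewrite !exprS E; ring.
Qed.

End Composition.

(** * Invariants after inverting [x], as polynomials fixed by translations of [y] *)

Section TranslationInvariants.

Variables (F : fieldType) (p : nat) (a0 a1 lam gam : F).
Hypothesis pF : p \in [pchar F].
Hypothesis translation_inj : injective (@translation F p a0 a1).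
Hypothesis gam_neq0 : gam != 0.

Local Notation x := (Defs.x F).
Local Notation y := (Defs.y F).
Local Notation z := (Defs.z F).
Local Notation R := {mpoly F[3]}.
Local Notation tau := (@translation F p a0 a1).

Definition specialize_y (c : R) : 3.-tuple R := [tuple x; c; z].

Definition shift_y (t : F) : 3.-tuple R := specialize_y (y + t%:MP).

Lemma comp_specialize_y (c d : R) f :
  (f \mPo specialize_y c) \mPo specialize_y d =
  f \mPo specialize_y (c \mPo specialize_y d).
Proof.
rewrite comp_mpolyA; congr comp_mpoly; apply: eq_from_tnth.
by apply: ord3P; rewrite !(tnth_nth 0) /= ?comp_mpolyXU.
Qed.

Lemma specialize_y_constant (c : F) (d : R) f :
  (f \mPo specialize_y c%:MP) \mPo specialize_y d = f \mPo specialize_y c%:MP.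
Proof. by rewrite comp_specialize_y comp_mpolyC. Qed.

Lemma linear_factor (t : F) f :
  f \mPo specialize_y (- t)%:MP = 0 -> exists q, f = (y + t%:MP) * q.
Proof.
move=> f0; have [|q E] := @comp_mpoly_mod F 3 (specialize_y (- t)%:MP) (y + t%:MP) f.
  apply: ord3P; rewrite !(tnth_nth 0) /=; [exists 0|exists (-1)|exists 0];
    by rewrite ?mpolyCN /Defs.x /Defs.y /Defs.z; ring.
by exists (- q); move/eqP: E; rewrite f0 eq_sym addr_eq0 mulrN => /eqP.
Qed.

Lemma linear_factors (s : seq F) f : uniq s ->
  (forall t, t \in s -> f \mPo specialize_y (- t)%:MP = 0) ->
  exists q, f = (\prod_(t <- s) (y + t%:MP)) * q.
Proof.
elim: s f => [|t s IHs] f; first by exists f; rewrite big_nil mul1r.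
move=> /= /andP[tns us] H; have [|q Eq] := @linear_factor t f.
  by apply: H; rewrite inE eqxx.
have [|q' Eq'] := IHs q us.
  move=> u us'; have := H u; rewrite inE us' orbT => /(_ isT).
  rewrite Eq rmorphM /= comp_mpolyD comp_mpolyC comp_mpolyXU /=.
  rewrite -mpolyCD => /eqP; rewrite mulf_eq0 => /orP[|/eqP //].
  rewrite mpolyC_eq0 addrC subr_eq0 => /eqP e.
  by rewrite e us' in tns.
by exists q'; rewrite Eq Eq' big_cons mulrA.
Qed.

(** This is L(y), the norm of [y] dehomogenized at [x = 1]. *)
Definition ell : R := \prod_(g : 'Z_p * 'Z_p) (y + (tau g)%:MP).

Lemma ellE : ell = additive_poly p a0%:MP a1%:MP y.
Proof.
rewrite -prod_additive_poly ?pchar_mpoly //; apply: eq_bigr => g _.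
by rewrite /translation mpolyCD !mpolyCMn.
Qed.

Lemma ell_shift (g : 'Z_p * 'Z_p) : ell \mPo shift_y (tau g) = ell.
Proof.
have pR := pchar_mpoly pF 3.
pose ev : {rmorphism R -> R} := comp_mpoly (shift_y (tau g)).
have evE : ev ell = additive_poly p a0%:MP a1%:MP (y - (- tau g)%:MP).
  rewrite ellE rmorph_additive_poly /= !comp_mpolyC comp_mpolyXU /=.
  by rewrite mpolyCN opprK.
rewrite -[LHS]/(ev _) evE additive_polyB // -ellE.
(* L vanishes at [- tau g]: the factor indexed by [g] is zero. *)
rewrite -prod_additive_poly // (bigD1 g) //= mpolyCN /translation.
by rewrite mpolyCD !mpolyCMn addNr mul0r subr0.
Qed.

Lemma has_lead_ell : has_lead ell (U_(1) *+ (p ^ 2)) 1.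
Proof.
rewrite -(card_ZpZp pF); apply: has_lead_prod => g.
have -> : (tau g)%:MP = tau g *: 'X_[0%MM] :> R by rewrite mpolyX0 alg_mpolyC.
apply/has_lead_monomial_add/supp_ltZ/supp_ltX.
by rewrite grevlex3E !mdeg3 !mnm0E !mnm1E.
Qed.

Lemma ell_neq0 : ell != 0.
Proof.
have [_ c] := has_lead_ell; apply: contra_eq_neq c => ->.
by rewrite mcoeff0 eq_sym oner_neq0.
Qed.

Lemma msize_ell : (1 < msize ell)%N.
Proof.
have [_ c] := has_lead_ell; have p0 := prime_gt0 (pcharf_prime pF).
have /msize_mdeg_lt : (U_(1) *+ (p ^ 2))%MM \in msupp ell.
  by rewrite mcoeff_msupp c oner_neq0.
rewrite mdeg3 !mulmnE !mnm1E /=; apply: leq_ltn_trans.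
by rewrite mul0n mul1n add0n addn0 expn_gt0 p0.
Qed.

Lemma msupp_specialize_y0 f :
  {subset msupp (f \mPo specialize_y 0) <= msupp f}.
Proof.
move=> I; rewrite comp_mpolyE => /msupp_sum_le /flatten_mapP[J].
rewrite mem_filter /= => Jf /msuppZ_le.
rewrite big_ord3 !(tnth_nth 0) /=.
have [J1|J1] := eqVneq (J 1%R) 0%N; last first.
  by rewrite expr0n (negbTE J1) mulr0 mul0r msupp0.
rewrite J1 expr0 mulr1 !mpolyXn -!mpolyXD msuppX inE => /eqP ->.
rewrite [X in X \in _](_ : _ = J) //.
by apply: mnm3_eq; rewrite !mnmDE !mulmnE !mnm1E /= ?J1; lia.
Qed.

Lemma msize_subset (f g : R) : {subset msupp f <= msupp g} -> (msize f <= msize g)%N.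
Proof.
move=> sub; rewrite [msize f]msizeE.
by apply/bigmax_leqP_seq => m /sub/msize_mdeg_lt.
Qed.

(** Invariance makes [g] minus its value at [y = 0] vanish at every [y = - tau h]. As the [tau h]
    are distinct, [ell] divides this difference; the quotient is again invariant and of smaller
    degree. *)
Lemma translation_invariantP (g : R) :
  (forall h, g \mPo shift_y (tau h) = g) ->
  exists h, g = h \mPo specialize_y ell.
Proof.
move: {2}(msize g) (leqnn (msize g)) => k.
elim: k g => [|k IHk] g.
  rewrite leqn0 msize_poly_eq0 => /eqP -> _.
  by exists 0; rewrite comp_mpoly0.
move=> szg inv_g; pose g0 := g \mPo specialize_y 0.
have g0_const d : g0 \mPo specialize_y d = g0.
  by rewrite /g0 -mpolyC0 specialize_y_constant.
have [q Eq] : exists q, g - g0 = ell * q.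
  have [||q ->] := @linear_factors [seq tau h | h <- enum {: 'Z_p * 'Z_p}] (g - g0).
  - by rewrite map_inj_uniq ?enum_uniq.
  - move=> _ /mapP[h _ ->]; rewrite comp_mpolyB g0_const -[in X in X - _](inv_g h).
    rewrite comp_specialize_y comp_mpolyD comp_mpolyC comp_mpolyXU /=.
    by rewrite mpolyCN addNr subrr.
  by exists q; rewrite big_map big_enum.
have inv_q h : q \mPo shift_y (tau h) = q.
  apply: (mulfI ell_neq0); rewrite -[in LHS](ell_shift h) -rmorphM /= -Eq.
  by rewrite comp_mpolyB inv_g g0_const.
have [q0|q_neq0] := eqVneq q 0.
  exists g0; rewrite g0_const; apply/eqP.
  by rewrite -subr_eq0 Eq q0 mulr0.
have [|h Eh] := IHk q _ inv_q.
  have : (msize (g - g0) <= msize g)%N.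
    apply: msize_subset => I /msuppB_le; rewrite mem_cat => /orP[//|].
    exact: msupp_specialize_y0.
  rewrite Eq msizeM ?ell_neq0 //; move: msize_ell szg.
  by move: (msize ell) (msize q) (msize g) => *; lia.
exists (g0 + y * h); rewrite comp_mpolyD g0_const rmorphM /= comp_mpolyXU /=.
by rewrite -Eh -Eq addrC subrK.
Qed.

(* y = x u and z = x (u^2 + lam u - w): in the coordinates x, u, w the group
   acts by translations of u alone, and quadratic_inv becomes x^2 w. *)
Definition chart : 3.-tuple R := [tuple x; x * y; x * (y ^+ 2 + lam *: y - z)].

Lemma chart_inj f : f \mPo chart = 0 -> f = 0.
Proof.
(* [s] solves [w = y^2 + lam y - z] for [z], so the chart followed by [s] is the monomial map
   [blowup], which is injective on monomials. *)
move=> f0; pose s : 3.-tuple R := [tuple x; y; y ^+ 2 + lam *: y - z].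
pose blowup : 3.-tuple R := [tuple x; x * y; x * z].
have {}f0 : f \mPo blowup = 0.
  suff -> : f \mPo blowup = (f \mPo chart) \mPo s by rewrite f0 comp_mpoly0.
  rewrite comp_mpolyA; congr comp_mpoly; apply: eq_from_tnth.
  apply: ord3P; rewrite !(tnth_nth 0) /=.
  - by rewrite comp_mpolyXU.
  - by rewrite rmorphM /= !comp_mpolyXU.
  rewrite rmorphM rmorphB rmorphD rmorphXn /= comp_mpolyZ !comp_mpolyXU /=.
  by rewrite opprD addNKr opprK.
pose phi (m : 'X_{1..3}) : 'X_{1..3} :=
  (U_(0%R) *+ (m 0%R + m 1%R + m 2%R) + U_(1%R) *+ m 1%R + U_(2%R) *+ m 2%R)%MM.
have phi_inj : injective phi.
  move=> m m' /mnmP e; move: (e 0) (e 1) (e 2).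
  by rewrite !mnmDE !mulmnE !mnm1E /= => *; apply: mnm3_eq; lia.
have monE m : 'X_[m] \mPo blowup = 'X_[phi m].
  rewrite comp_mpolyX big_ord3 !(tnth_nth 0) /=.
  rewrite /phi !mpolyXD -!mpolyXn !exprMn !exprD.
  rewrite /Defs.x /Defs.y /Defs.z; ring.
apply/mpolyP => m; rewrite mcoeff0 -[RHS](mcoeff0 _ (phi m)) -f0 comp_mpolyE.
rewrite {1}(mpolyE f) !raddf_sum /=; apply: eq_bigr => m' _.
by rewrite -comp_mpolyX monE !mcoeffZ !mcoeffX (inj_eq phi_inj).
Qed.

Local Notation b := (normalized_generators p a0 a1 lam gam).

Lemma chart_norm_y : norm_y p a0 a1 \mPo chart = x ^+ (p ^ 2) * ell.
Proof.
rewrite /norm_y /ell -(card_ZpZp pF) -prodr_const -big_split rmorph_prod /=.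
apply: eq_bigr => g _.
rewrite comp_mpolyD comp_mpolyZ !comp_mpolyXU /= -mul_mpolyC; ring.
Qed.

Lemma chart_quadratic_inv : quadratic_inv lam \mPo chart = x ^+ 2 * z.
Proof.
rewrite /quadratic_inv /delta !(comp_mpolyD, comp_mpolyN, comp_mpolyZ).
rewrite !(rmorphM, rmorphXn) /= !comp_mpolyXU /= -!mul_mpolyC; ring.
Qed.

Definition elementary (t : F) := elementary_images t (lam * t).

Lemma chart_elementary t f :
  (f \mPo chart) \mPo shift_y t = (f \mPo elementary t) \mPo chart.
Proof.
rewrite comp_mpolyA [RHS]comp_mpolyA.
apply: (congr1 (fun s => comp_mpoly s f)); apply: eq_from_tnth.
apply: ord3P; rewrite !(tnth_nth 0) /=.
- by rewrite !comp_mpolyXU.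
- rewrite comp_mpolyD comp_mpolyZ rmorphM /= !comp_mpolyXU /= -mul_mpolyC; ring.
rewrite !(comp_mpolyD, comp_mpolyN, comp_mpolyZ, rmorphM, rmorphXn) /=.
rewrite !(comp_mpolyD, comp_mpolyN, comp_mpolyZ, rmorphM, rmorphXn) /=.
rewrite !comp_mpolyXU /= -!mul_mpolyC !(rmorphD, rmorphM, rmorphXn) /=; ring.
Qed.

(** In the chart [f] becomes a polynomial in [x], [ell] and [z]. There [ell] and [z] are the values
    of the norm of [y] and of [quadratic_inv] up to powers of [x], so clearing denominators
    suffices. *)
Lemma localization f : (forall g, f \mPo elementary (tau g) = f) ->
  exists e h, x ^+ e * f = h \mPo b.
Proof.
move=> inv_f; have [|h0 Eh0] := @translation_invariantP (f \mPo chart).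
  by move=> g; rewrite chart_elementary inv_f.
suff [e [h E]] : exists e h,
    x ^+ e * (h0 \mPo specialize_y ell) = (h \mPo b) \mPo chart.
  exists e, h; apply/eqP; rewrite -subr_eq0; apply/eqP/chart_inj.
  rewrite comp_mpolyB -E -Eh0 rmorphM rmorphXn /= comp_mpolyXU /=.
  by rewrite subrr.
elim/mpolyind: h0 {Eh0} => [|c m h0 _ _ [e [h E]]].
  by exists 0%N, 0; rewrite !comp_mpoly0 mulr0.
(* Each [ell] costs [x^(p^2)] and each [z] costs [x^2]; the extra [e] serves the remaining terms,
   and [gam^-1] rescales the second generator to [quadratic_inv]. *)
exists (p ^ 2 * m 1%R + 2 * m 2%R + e)%N,
  ((c * gam^-1 ^+ m 2%R) *: ('X_0 ^+ (e + m 0%R) * 'X_2 ^+ m 1%R * 'X_1 ^+ m 2%R)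
   + 'X_0 ^+ (p ^ 2 * m 1%R + 2 * m 2%R) * h).
rewrite 3!comp_mpolyD comp_mpolyZ comp_mpolyX.
rewrite big_ord3 !(tnth_nth 0) /=.
rewrite mulrDr [in X in _ + X = _]exprD -[_ * _ * (h0 \mPo _)]mulrA E.
rewrite !(comp_mpolyZ, rmorphM, rmorphXn) /= !comp_mpolyXU /=.
rewrite comp_mpolyZ chart_norm_y chart_quadratic_inv; congr (_ + _).
rewrite -!mul_mpolyC !exprMn -!rmorphXn mpolyCM !exprD !exprM.
rewrite !rmorphXn /=.
have E1 : (gam^-1)%:MP ^+ m 2%R * gam%:MP ^+ m 2%R = 1 :> R.
  by rewrite -exprMn -mpolyCM mulVf // expr1n.
rewrite -[LHS]mul1r -E1; ring.
Qed.

End TranslationInvariants.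

(** * The representation [V_M]: translations, orbit products and invariants *)

Section Invariants.

Variables (F : fieldType) (p : nat) (M : 'M[F]_2).
Hypothesis p_gt2 : (2 < p)%N.
Hypothesis pF : p \in [pchar F].
Hypothesis gamma13_neq0 : gamma_minor p M 0 2 != 0.
Hypothesis gamma12_eq0 : gamma_minor p M 0 1 = 0.

Local Notation x := (Defs.x F).
Local Notation y := (Defs.y F).
Local Notation z := (Defs.z F).
Local Notation R := {mpoly F[3]}.
Let p_pr : prime p := pcharf_prime pF.
Local Notation gam := (gamma_minor p M 0 2).
Local Notation lam := (M 1 0 / M 0 0).
Local Notation tau := (@translation F p (M 0 0) (M 0 1)).
Local Notation elem := (elementary lam).

Lemma gamma_minorE i j : gamma_minor p M i j =
  gamma_matrix p M i 0 * gamma_matrix p M j 1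
  - gamma_matrix p M i 1 * gamma_matrix p M j 0.
Proof. by rewrite /gamma_minor det2 !mxE !(tnth_nth 0) /=. Qed.

Lemma gamma13E : gam = M 0 0 * M 0 1 ^+ p - M 0 1 * M 0 0 ^+ p.
Proof. by rewrite gamma_minorE !mxE. Qed.

Lemma M00_neq0 : M 0 0 != 0.
Proof.
apply: contraNneq gamma13_neq0 => M0; rewrite gamma13E M0 mul0r expr0n.
by rewrite (gtn_eqF (prime_gt0 p_pr)) mulr0 subr0.
Qed.

Lemma M10E : M 1 0 = lam * M 0 0.
Proof. by rewrite divfK ?M00_neq0. Qed.

(** The vanishing minor makes the rows of [M] proportional, with ratio [lam]; hence the single
    parameter [tau g] governs the action. *)
Lemma M11E : M 1 1 = lam * M 0 1.
Proof.
move: gamma12_eq0; rewrite gamma_minorE !mxE /= => /eqP; rewrite subr_eq0 => /eqP e.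
apply: (mulfI M00_neq0).
by rewrite e mulrA [M 0 0 * _]mulrC divfK ?M00_neq0 // mulrC.
Qed.

Lemma gamma23E : gamma_minor p M 1 2 = gam * lam.
Proof.
rewrite !gamma_minorE !mxE /=; move: M10E M11E; move: lam => l -> ->; ring.
Qed.

(** [gam] is the Moore determinant of [M 0 0] and [M 0 1]. A linear relation over the prime field
    and its image under Frobenius form a system with determinant [gam], so Cramer's rule forces it
    to be trivial. *)
Lemma translation_inj : injective tau.
Proof.
case=> [i j] [i' j']; rewrite /translation /=.
rewrite -(mulr_natr _ i) -(mulr_natr _ i') -(mulr_natr _ j) -(mulr_natr _ j').
have natX (k : nat) : k%:R ^+ p = k%:R :> F.
  by rewrite -(pFrobenius_autE pF) pFrobenius_aut_nat.
have natBX (k l : nat) : (k%:R - l%:R) ^+ p = k%:R - l%:R :> F.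
  rewrite -(pFrobenius_autE pF) pFrobenius_autB_comm; last exact: mulrC.
  by rewrite !pFrobenius_aut_nat.
set u := i%:R - i'%:R : F; set v := j%:R - j'%:R : F => e.
have e1 : M 0 0 * u + M 0 1 * v = 0.
  by move/eqP: e; rewrite -subr_eq0 => /eqP <-; rewrite /u /v; ring.
have e2 : M 0 0 ^+ p * u + M 0 1 ^+ p * v = 0.
  rewrite -[u]natBX -[v]natBX -!exprMn -!(pFrobenius_autE pF).
  rewrite -pFrobenius_autD_comm; last exact: mulrC.
  by rewrite e1 pFrobenius_aut0.
have u0 : u = 0.
  have : gam * u = M 0 1 ^+ p * (M 0 0 * u + M 0 1 * v)
     - M 0 1 * (M 0 0 ^+ p * u + M 0 1 ^+ p * v) by rewrite gamma13E; ring.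
  rewrite e1 e2 !mulr0 subrr => /eqP; rewrite mulf_eq0 (negbTE gamma13_neq0).
  by move/eqP.
have v0 : v = 0.
  have : gam * v = M 0 0 * (M 0 0 ^+ p * u + M 0 1 ^+ p * v)
     - M 0 0 ^+ p * (M 0 0 * u + M 0 1 * v) by rewrite gamma13E; ring.
  rewrite e1 e2 !mulr0 subrr => /eqP; rewrite mulf_eq0 (negbTE gamma13_neq0).
  by move/eqP.
move/eqP: u0; rewrite subr_eq0 => /eqP/(natr_Zp_inj pF) ->.
by move/eqP: v0; rewrite subr_eq0 => /eqP/(natr_Zp_inj pF) ->.
Qed.

Lemma act_elementary (g : 'Z_p * 'Z_p) (f : R) : act M g f = f \mPo elem (tau g).
Proof.
rewrite actE /elementary /translation; congr (_ \mPo elementary_images _ _).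
by move: M10E M11E; move: lam => l -> ->; rewrite mulrDr !mulrnAr.
Qed.

Lemma two_neq0 : 2%:R != 0 :> F.
Proof. by rewrite -(dvdn_pcharf pF) gtnNdvd. Qed.

Lemma act_y g : act M g y = y + tau g *: x.
Proof. by rewrite act_elementary comp_mpolyXU. Qed.

Lemma act_z g : act M g z = z + (2%:R * tau g) *: y
  + (tau g ^+ 2 + lam * tau g) *: x.
Proof. by rewrite act_elementary comp_mpolyXU. Qed.

(** With trivial stabilizer, removing duplicates from the orbit removes nothing. *)
Lemma orbit_productE f : injective (fun g : 'Z_p * 'Z_p => act M g f) ->
  orbit_product p M f = \prod_(g : 'Z_p * 'Z_p) act M g f.
Proof.
move=> inj; rewrite /orbit_product undup_id ?big_image //.
by rewrite map_inj_uniq ?enum_uniq.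
Qed.

Lemma act_y_inj : injective (fun g : 'Z_p * 'Z_p => act M g y).
Proof.
move=> g h; rewrite !act_y => /(congr1 (mcoeff U_(0))).
by rewrite !mcoeffD !mcoeffZ !mcoeffXU /= !mulr1 !add0r => /translation_inj.
Qed.

(** The coefficient [2 tau g] of [y] already separates the images, as p is odd. *)
Lemma act_z_inj : injective (fun g : 'Z_p * 'Z_p => act M g z).
Proof.
move=> g h; rewrite !act_z => /(congr1 (mcoeff U_(1))).
rewrite !mcoeffD !mcoeffZ !mcoeffXU /= !mulr0 !mulr1 !add0r !addr0.
by move/(mulfI two_neq0)/translation_inj.
Qed.

Lemma orbit_product_y : orbit_product p M y = norm_y p (M 0 0) (M 0 1).
Proof.
by rewrite (orbit_productE act_y_inj); apply: eq_bigr => g _; rewrite act_y.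
Qed.

Lemma orbit_product_z : orbit_product p M z = norm_z p (M 0 0) (M 0 1) lam.
Proof.
by rewrite (orbit_productE act_z_inj); apply: eq_bigr => g _; rewrite act_z.
Qed.

Lemma d_invE : d_inv p M = gam *: quadratic_inv lam.
Proof. by rewrite /d_inv gamma23E -scalerA -scalerDr. Qed.

Lemma VM_generatorsE :
  VM_generators p M = normalized_generators p (M 0 0) (M 0 1) lam gam.
Proof.
rewrite /VM_generators /normalized_generators orbit_product_y orbit_product_z.
by rewrite d_invE.
Qed.

Local Notation b := (VM_generators p M).

Lemma invariantsP f :
  reflect (forall g, f \mPo elem (tau g) = f) (f \in invariants p M).
Proof.
apply: (iffP forallP) => H g; last by rewrite act_elementary H.
by rewrite -act_elementary; apply/eqP.
Qed.

Lemma orbit_product_invariant f : injective (fun g : 'Z_p * 'Z_p => act M g f) ->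
  orbit_product p M f \in invariants p M.
Proof.
move=> inj; apply/invariantsP => h; rewrite orbit_productE // rmorph_prod /=.
rewrite [RHS](reindex_inj (addIr h)); apply: eq_bigr => g _.
by rewrite actD // [RHS]act_elementary.
Qed.

Lemma VM_generators_invariant f : f \in b -> f \in invariants p M.
Proof.
rewrite !inE => /or4P[]/eqP ->.
- by apply/invariantsP => g; rewrite comp_mpolyXU.
- apply/invariantsP => g; rewrite d_invE comp_mpolyZ.
  congr (_ *: _); rewrite /quadratic_inv /delta comp_mpolyD comp_mpolyB comp_mpolyZ.
  rewrite !(rmorphM, rmorphXn) /= !comp_mpolyXU /= -!mul_mpolyC.
  by rewrite !(rmorphD, rmorphM, rmorphXn) /=; ring.
- exact: orbit_product_invariant act_y_inj.
- exact: orbit_product_invariant act_z_inj.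
Qed.

Lemma invariantsM f g :
  f \in invariants p M -> g \in invariants p M -> f * g \in invariants p M.
Proof.
move=> /invariantsP Hf /invariantsP Hg; apply/invariantsP => h.
by rewrite rmorphM /= Hf Hg.
Qed.

Lemma invariants1 : 1 \in invariants p M.
Proof. by apply/invariantsP => h; rewrite rmorph1. Qed.

Lemma invariants_comp (h : {mpoly F[4]}) : h \mPo b \in invariants p M.
Proof.
apply/invariantsP => g; rewrite comp_mpolyA; congr comp_mpoly.
apply: eq_from_tnth => i; rewrite tnth_map.
by apply/invariantsP/VM_generators_invariant/mem_tnth.
Qed.

(** * Lead monomials of the generators and normal forms of invariants *)

Lemma has_lead_norm_y : has_lead (tnth b 2) (U_(1) *+ (p ^ 2)) 1.
Proof.
rewrite (tnth_nth 0) /= orbit_product_y -(card_ZpZp pF).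
apply: has_lead_prod => g; apply/has_lead_monomial_add/supp_ltZ/supp_ltX.
by rewrite grevlex3E !mdeg3 !mnm1E.
Qed.

Lemma has_lead_norm_z : has_lead (tnth b 3) (U_(2) *+ (p ^ 2)) 1.
Proof.
rewrite (tnth_nth 0) /= orbit_product_z -(card_ZpZp pF).
apply: has_lead_prod => g; rewrite -addrA; apply/has_lead_monomial_add/supp_ltD;
  by apply/supp_ltZ/supp_ltX; rewrite grevlex3E !mdeg3 !mnm1E.
Qed.

Lemma has_lead_d : has_lead (tnth b 1) (U_(1) *+ 2) gam.
Proof.
rewrite (tnth_nth 0) /= d_invE.
have [le c] : has_lead (quadratic_inv lam) (U_(1) *+ 2) 1.
  rewrite /quadratic_inv /delta /y mpolyXn -addrA.
  apply/has_lead_monomial_add/supp_ltD.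
    rewrite -scaleN1r -mpolyXD; apply/supp_ltZ/supp_ltX.
    by rewrite grevlex3E !mdeg3 !mnmDE !mnm1E.
  rewrite -mpolyXD; apply/supp_ltZ/supp_ltX.
  by rewrite grevlex3E !mdeg3 !mnmDE !mnm1E.
by split; [exact: supp_leZ | rewrite mcoeffZ c mulr1].
Qed.

Let lead0 : is_lead_mon (tnth b 0) U_(0).
Proof.
rewrite (tnth_nth 0); apply/is_lead_monP; rewrite mcoeffX eqxx oner_neq0.
by split=> //; apply: supp_leX.
Qed.
Let lead1 := has_lead_is_lead_mon gamma13_neq0 has_lead_d.
Let lead2 := has_lead_is_lead_mon (oner_neq0 F) has_lead_norm_y.
Let lead3 := has_lead_is_lead_mon (oner_neq0 F) has_lead_norm_z.

Let q_odd : odd (p ^ 2).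
Proof. by case: (even_prime p_pr) p_gt2 => [->|]; rewrite // oddX => ->. Qed.

Lemma relation_normal_form (h : {mpoly F[4]}) :
  exists2 h', normal_form h' & h \mPo b = h' \mPo b.
Proof.
have [r [r0 nr]] := exists_relation (M 0 0) (M 0 1) lam pF gamma13_neq0.
have [u [h' [-> nh']]] := normal_form_division (oner_neq0 F) nr h.
exists h' => //; rewrite comp_mpolyD rmorphM /= VM_generatorsE r0.
by rewrite mulr0 add0r.
Qed.

(* If h had a term free of X_0, then the part h0 of h formed by those terms
   would give h0(b) a lead monomial not divisible by x. *)
Lemma normal_form_div_x (h : {mpoly F[4]}) (f : R) : normal_form h ->
  x * f = h \mPo b -> exists2 h', normal_form h' & f = h' \mPo b.
Proof.
move=> nh E.
pose h0 := \sum_(I <- msupp h | I 0%R == 0%N) h@_I *: 'X_[I].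
pose q := \sum_(I <- msupp h | I 0%R != 0%N) h@_I *: 'X_[(I - U_(0%R))%MM].
have hE : h = h0 + 'X_0 * q.
  rewrite {1}(mpolyE h) (bigID (fun I : 'X_{1..4} => I 0%R == 0%N)) /=.
  congr (_ + _); rewrite /q mulr_sumr; apply: eq_bigr => I I0.
  rewrite -scalerAr -mpolyXD addmC submK //.
  by apply/mnm_lepP => i; rewrite mnm1E; case: eqP => [<-|] //; rewrite lt0n.
have h0supp I : I \in msupp h0 -> I \in msupp h /\ I 0%R = 0%N.
  move=> /msupp_sum_le /flatten_mapP[J]; rewrite mem_filter => /andP[/eqP J0 Jh].
  by move/msuppZ_le; rewrite msuppX inE => /eqP ->.
have nq : normal_form q.
  move=> I /msupp_sum_le /flatten_mapP[J]; rewrite mem_filter => /andP[_ Jh].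
  move/msuppZ_le; rewrite msuppX inE => /eqP ->; rewrite mnmBE mnm1E subn0.
  exact: nh.
exists q => //; apply: (mulfI (_ : x != 0)).
  apply/eqP => x0; have /is_lead_monP[_] := lead0.
  by rewrite (tnth_nth 0) /= x0 mcoeff0 eqxx.
have xE : x * (f - (q \mPo b)) = h0 \mPo b.
  by rewrite mulrBr E {1}hE comp_mpolyD rmorphM /= comp_mpolyXU addrK.
suff h00 : h0 = 0 by move/eqP: xE; rewrite h00 comp_mpoly0 mulrBr subr_eq0 => /eqP.
apply/eqP/contraT => /(normal_form_lead q_odd lead0 lead1 lead2 lead3).
case=> [I /h0supp[/nh] //|I /h0supp[_ I0] [/andP[]]].
rewrite -xE => /msuppM_le /allpairsP[[J K] /= []]; rewrite msuppX inE => /eqP ->.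
move=> _ /(congr1 (fun m : 'X_{1..3} => m 0%R)).
have [eI _ _] := lead_exponentE (p ^ 2) I.
by rewrite eI I0 mnmDE mnm1E.
Qed.

(** Some x^e f is a polynomial in the generators, hence the value of a normal form; the factors [x]
    are then cancelled one at a time. *)
Lemma invariant_normal_form f : f \in invariants p M ->
  exists2 h, normal_form h & f = h \mPo b.
Proof.
move=> /invariantsP /(localization pF translation_inj gamma13_neq0)[e [h]].
rewrite -VM_generatorsE => E; have [h' nh' Eh'] := relation_normal_form h.
move: E; rewrite {}Eh'; elim: e h' nh' => [|e IHe] h' nh'.
  by rewrite mul1r => ->; exists h'.
rewrite exprS -mulrA => /(normal_form_div_x nh')[h2 nh2]; exact: IHe.
Qed.

(** * The SAGBI property and the ideal of relations *)

Lemma sagbi_basis_VM_generators : sagbi_basis (invariants p M) (mem b).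
Proof.
split; first by move=> f fb; apply: VM_generators_invariant.
move=> f; split=> [[k [s [q [Hs ->]]]]|[k [c [s [Hs ->]]]]].
  (* A product of lead monomials of generators is the lead monomial of the product of those
     generators, which is invariant. *)
  rewrite (mpolyE q) raddf_sum /= big_tnth.
  pose I i := tnth (in_tuple (msupp q)) i.
  exists (size (msupp q)), (fun i => q@_(I i)), (fun i => 'X_[I i] \mPo s).
  split; last by apply: eq_bigr => i _; rewrite comp_mpolyZ.
  move=> i; rewrite comp_mpolyX; elim/big_ind: _ => [|g1 g2 H1 H2|j _].
  - exists 1, 0%MM; rewrite mpolyX0 invariants1; split=> //.
    exact/(has_lead_is_lead_mon (oner_neq0 F))/has_lead1.
  - have [f1 [m1 [i1 l1 ->]]] := H1; have [f2 [m2 [i2 l2 ->]]] := H2.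
    exists (f1 * f2), (m1 + m2)%MM; rewrite invariantsM // mpolyXD; split=> //.
    exact: is_lead_monM.
  have [g [m [gb lg ->]]] := Hs j.
  exists (g ^+ I i j), (m *+ I i j)%MM; rewrite mpolyXn; split=> //.
    elim: (I i j) => [|k' IHk]; first exact: invariants1.
    by rewrite exprS; apply: invariantsM IHk; apply: VM_generators_invariant.
  exact: is_lead_monXn.
(* Conversely, [S] lists the lead monomials of the generators, and by normal forms the lead monomial
   of any nonzero invariant is a monomial in [S]. *)
pose S : 4.-tuple R := [tuple 'X_[U_(0)]; 'X_[U_(1) *+ 2]; 'X_[U_(1) *+ (p ^ 2)];
  'X_[U_(2) *+ (p ^ 2)]].
have SE I : 'X_[I] \mPo S = 'X_[lead_exponent (p ^ 2) I].
  rewrite comp_mpolyX big_ord4 !(tnth_nth 0) /= !mpolyXn -!mpolyXD.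
  by congr 'X_[_]; apply/mnmP => i; rewrite !mnmDE !mulmnE; lia.
have HI i : exists I, s i = 'X_[lead_exponent (p ^ 2) I].
  have [g [m [/invariant_normal_form[h nh ->] lg ->]]] := Hs i.
  have h0 : h != 0.
    by apply/eqP => h0; case/andP: lg; rewrite h0 comp_mpoly0 msupp0.
  have [I _ [lI _]] := normal_form_lead q_odd lead0 lead1 lead2 lead3 nh h0.
  by exists I; rewrite (is_lead_mon_uniq lg lI).
have {}HI := fin_all_exists HI; case: HI => I HI.
exists 4, S, (\sum_i c i *: 'X_[I i]); split; last first.
  rewrite raddf_sum /=; apply: eq_bigr => i _.
  by rewrite comp_mpolyZ SE HI.
apply: ord4P; rewrite !(tnth_nth 0) /=.
- by exists (tnth b 0), U_(0%R)%MM; split; first exact: mem_tnth.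
- by exists (tnth b 1), (U_(1%R) *+ 2)%MM; split; first exact: mem_tnth.
- by exists (tnth b 2), (U_(1%R) *+ (p ^ 2))%MM; split; first exact: mem_tnth.
- by exists (tnth b 3), (U_(2%R) *+ (p ^ 2))%MM; split; first exact: mem_tnth.
Qed.

Definition tete_a_tete : {mpoly F[4]} :=
  'X_1 ^+ (p ^ 2) - gam ^+ (p ^ 2) *: 'X_2 ^+ 2.

(** Both terms have lead monomial y^(2p^2) with coefficient gam^(p^2), and these cancel. *)
Lemma tete_a_tete_supp_lt :
  supp_lt (U_(1) *+ (2 * p ^ 2)) (tete_a_tete \mPo b).
Proof.
rewrite /tete_a_tete comp_mpolyB comp_mpolyZ !rmorphXn /= !comp_mpolyXU.
have := has_leadXn (p ^ 2) has_lead_d; have := has_leadXn 2 has_lead_norm_y.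
rewrite !(tnth_nth 0) expr1n.
rewrite (_ : (U_(1) *+ (p ^ 2) *+ 2)%MM = U_(1) *+ (2 * p ^ 2))%MM; last first.
  by apply/mnmP => i; rewrite !mulmnE; lia.
rewrite (_ : (U_(1) *+ 2 *+ (p ^ 2))%MM = U_(1) *+ (2 * p ^ 2))%MM; last first.
  by apply/mnmP => i; rewrite !mulmnE; lia.
move=> [le2 c2] [le1 c1]; apply: supp_ltP.
  by rewrite -scaleN1r scalerA; apply/supp_leD/supp_leZ.
by rewrite mcoeffB mcoeffZ c1 c2 mulr1 subrr.
Qed.

Lemma exists_subduction_relation : exists r, subduction_relation b tete_a_tete r.
Proof.
have [h nh E] := invariant_normal_form (invariants_comp tete_a_tete).
exists (tete_a_tete - h), h => //; rewrite E.
exact: (normal_form_subducts q_odd lead0 lead1 lead2 lead3).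
Qed.

(** If [I 2] were at least 2, the degree would be at least 2p^2, with equality only for y^(2p^2)
    itself. *)
Lemma small_lead_exponent I :
  grevlex_lt (lead_exponent (p ^ 2) I) (U_(1) *+ (2 * p ^ 2)) -> (I 2%R <= 1)%N.
Proof.
have [e0 e1 e2] := lead_exponentE (p ^ 2) I.
rewrite grevlex3E !mdeg3 e0 e1 e2 !mulmnE !mnm1E /= => H.
rewrite -ltnS -(@ltn_pmul2l (p ^ 2)) ?expn_gt0 ?prime_gt0 //; lia.
Qed.

(** Whatever run produced [r], the subtracted products lie below y^(2p^2) and so have degree at most
    1 in [X_2]. Division by [r] therefore leaves a normal form, and a normal form that is a relation
    is zero. *)
Lemma subduction_relation_generates r : subduction_relation b tete_a_tete r ->
  relation_ideal_generated_by b r.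
Proof.
case=> q sq ->; have Eq := subduction_comp sq.
have rel0 : (tete_a_tete - q) \mPo b = 0 by rewrite comp_mpolyB Eq subrr.
have nq : normal_form q.
  move=> I Iq; apply: small_lead_exponent.
  exact: (subduction_exponents q_odd lead0 lead1 lead2 lead3 sq tete_a_tete_supp_lt).
(* This is the coefficient of [X_2^2] in [r]; the other terms of [r] are [X_1^(p^2)] and those of
   [- q]. *)
have c0 : - gam ^+ (p ^ 2) != 0 by rewrite oppr_eq0 expf_neq0.
have nr : normal_form (tete_a_tete - q - (- gam ^+ (p ^ 2)) *: 'X_2 ^+ 2).
  rewrite scaleNr opprK addrAC /tete_a_tete subrK -scaleN1r.
  apply/normal_formD/normal_formZ => // I.
  by rewrite mpolyXn msuppX inE => /eqP ->; rewrite mulmnE mnm1E.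
move=> h; split=> [h0|[u ->]]; last by rewrite rmorphM /= rel0 mulr0.
have [u [h' [E nh']]] := normal_form_division c0 nr h.
exists u; rewrite E (normal_form_eq0 q_odd lead0 lead1 lead2 lead3 nh') ?addr0 //.
by move: h0; rewrite E comp_mpolyD rmorphM /= rel0 mulr0 add0r.
Qed.

End Invariants.

Theorem theorem7p5 (p : nat) (F : fieldType) (M : 'M[F]_2)
    (p_prime : prime p) (p_gt2 : (2 < p)%N) (pcharF : p \in [pchar F])
    (gamma13_neq0 : gamma_minor p M 0 2 != 0)
    (gamma12_eq0 : gamma_minor p M 0 1 = 0) :
  let b := VM_generators p M in
  let P : {mpoly F[4]} :=
    'X_1 ^+ (p ^ 2) - gamma_minor p M 0 2 ^+ (p ^ 2) *: 'X_2 ^+ 2 in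
  sagbi_basis (invariants p M) (mem b) /\
  (exists r, subduction_relation b P r) /\
  (forall r, subduction_relation b P r -> relation_ideal_generated_by b r).
Proof.
split; first exact: sagbi_basis_VM_generators.
split; first exact: exists_subduction_relation.
exact: subduction_relation_generates.
Qed.
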